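(* Let $V$ be a variety defined over a field $k$ with $\dim(V)>0$. Assume that the set $V(k)$ of $k$-rational points is Zariski-dense in $V$. Then there exists an infinite subset $\Gamma\subset V(k)$ such that for every proper subvariety $Z\subsetneq V$ the intersection $\Gamma\cap Z$ is finite.
   Context: Varieties are irreducible; a proper subvariety of $V$ is a Zariski-closed subvariety different from $V$. *)

(* Defs.v *)
From HB Require Import structures.
From mathcomp Require Import all_boot all_order all_algebra.
From mathcomp Require Import mpoly.
From mathcomp Require Import boolp classical_sets functions cardinality topology.

Set Implicit Arguments.
Unset Strict Implicit.
Unset Printing Implicit Defensive.

Import GRing.Theory.
Local Open Scope classical_set_scope.
Local Open Scope ring_scope.

Section Affine.
Variables (K : fieldType) (n : nat).

Definition poly_eval (p : {mpoly K[n]}) (a : 'rV[K]_n) : K :=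
  p.@[fun j => a 0 j].

Definition zero_locus (S : set {mpoly K[n]}) : set 'rV[K]_n :=
  [set a | forall p, S p -> poly_eval p a = 0].

Definition vanishing_ideal (X : set 'rV[K]_n) : set {mpoly K[n]} :=
  [set p | forall a, X a -> poly_eval p a = 0].

Definition zariski_closed (X : set 'rV[K]_n) : Prop :=
  exists S, X = zero_locus S.

End Affine.

Section FieldOfDefinition.
Variables (k : fieldType) (K : fieldType) (iota : {rmorphism k -> K}) (n : nat).

Definition extend_poly (f : {mpoly k[n]}) : {mpoly K[n]} :=
  map_mpoly iota f.

Definition k_closed (X : set 'rV[K]_n) : Prop :=
  exists S : set {mpoly k[n]}, X = zero_locus (extend_poly @` S).

(** The ideal of [X] in [K[x_1, ..., x_n]] is generated by polynomials with
    coefficients in [k].  Over an imperfect field [k] this is stronger than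
    [k_closed X]. *)
Definition defined_over (X : set 'rV[K]_n) : Prop :=
  zariski_closed X /\
  forall p, vanishing_ideal X p ->
    exists (m : nat) (g : 'I_m -> {mpoly K[n]}) (f : 'I_m -> {mpoly k[n]}),
      (forall j, vanishing_ideal X (extend_poly (f j))) /\
      p = \sum_(j < m) g j * extend_poly (f j).

Definition rational_vector (a : 'rV[K]_n) : Prop :=
  exists b : 'rV[k]_n, a = map_mx iota b.

End FieldOfDefinition.

Section Topology.
Variable T : topologicalType.

Definition irreducible_set (A : set T) : Prop :=
  A !=set0 /\
  forall F G : set T, closed F -> closed G -> A `<=` F `|` G ->
    A `<=` F \/ A `<=` G.

Definition has_chain (d : nat) : Prop :=
  exists Z : nat -> set T,
    (forall i, (i <= d)%N -> closed (Z i) /\ irreducible_set (Z i)) /\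
    (forall i, (i < d)%N -> Z i `<` Z i.+1).

(** Krull dimension.  The value is [0] when the lengths of the chains are not
    bounded, which does not happen for a variety. *)
Definition krull_dim : nat :=
  xget 0%N [set d | has_chain d /\ forall e, has_chain e -> (e <= d)%N].

End Topology.

(** A variety over the algebraically closed field [K], defined over the
    subfield [iota k]: an irreducible separated space with a finite atlas whose
    charts identify the open sets [dom i] with affine algebraic sets defined
    over [k], and whose transition maps are regular and defined over [k].
    [chart i] is meaningful only on [dom i]. *)
Record variety (k : fieldType) (K : closedFieldType)
    (iota : {rmorphism k -> K}) : Type := Variety {
  space :> topologicalType;
  chart_index : finType;
  emb_dim : chart_index -> nat;
  dom : chart_index -> set space;
  chart : forall i, space -> 'rV[K]_(emb_dim i);
  dom_cover : forall x, exists i, dom i x;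
  chart_inj : forall i x y, dom i x -> dom i y -> chart i x = chart i y -> x = y;
  chart_image : forall i, defined_over iota (chart i @` dom i);
  (** The topology is glued from the Zariski topologies of the charts. *)
  closedE : forall Z : set space,
    closed Z <-> forall i, zariski_closed (chart i @` (dom i `&` Z));
  (** [dom i `&` dom j] is open in [dom i], with complement defined by
      equations over [k]. *)
  overlap : forall i j, k_closed iota (chart i @` (dom i `\` dom j));
  (** Each coordinate of a transition map is, around every point, a quotient
      of polynomials over [k]. *)
  transition : forall i j (l : 'I_(emb_dim j)) x, dom i x -> dom j x ->
    exists p q : {mpoly k[emb_dim i]},
      poly_eval (extend_poly iota q) (chart i x) != 0 /\
      forall y, dom i y -> dom j y ->
        poly_eval (extend_poly iota q) (chart i y) != 0 ->
        chart j y 0 l = poly_eval (extend_poly iota p) (chart i y)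
                        / poly_eval (extend_poly iota q) (chart i y);
  (** The diagonal is closed in the product: [dom i] times [dom j] is a chart
      of the product. *)
  separated : forall i j,
    exists S : set {mpoly K[emb_dim i + emb_dim j]},
      forall x y, dom i x -> dom j y ->
        x = y <-> zero_locus S (row_mx (chart i x) (chart j y));
  variety_irreducible : irreducible_set [set: space]
}.

Section VarietyNotions.
Variables (k : fieldType) (K : closedFieldType) (iota : {rmorphism k -> K}).
Variable V : variety iota.

(** As transition maps are defined over [k], rationality does not depend on the
    chart. *)
Definition rational_points : set V :=
  [set x | exists i, dom i x /\ rational_vector iota (chart i x)].

(** Subvarieties are geometric: no field of definition is prescribed. *)
Definition subvariety (Z : set V) : Prop := closed Z /\ irreducible_set Z.

Definition proper_subvariety (Z : set V) : Prop :=
  subvariety Z /\ Z <> [set: V].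

End VarietyNotions.

Arguments rational_points {k K iota} V.

(* Main.v *)
Require Import Defs.
From HB Require Import structures.
From mathcomp Require Import all_boot all_order all_algebra.
From mathcomp Require Import mpoly.
From mathcomp Require Import boolp classical_sets functions cardinality topology.
Import GRing.Theory.
Local Open Scope classical_set_scope.
Local Open Scope ring_scope.

(** The set Gamma is a sequence of rational points in general position.

    Fix a nonempty chart domain [dom i], and for every [d] let [e_d x] be the
    vector of the values at [chart i x] of all monomials of degree less than
    [d]; it lives in a space of finite dimension [N d].  The points are chosen
    one after another: the [n]-th point [x] is a rational point such that, for
    every [d <= n] and every subsequence [t] of the points already chosen,
    [e_d x] is outside the span of [e_d t] unless this span contains all of
    [e_d (dom i)].  Each of these finitely many conditions restricts [x] to a
    nonempty open set ([off_subspace_open]), so, as the variety is irreducible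
    and its rational points are dense, they can be met together
    ([irreducible_dense_meets_opens]).

    Let now [Z] be a proper closed subset.  Some polynomial [r] on the chart
    vanishes on [Z] but not on all of [dom i]; that is, the vectors [e_d z]
    with [z] in [Z] lie in a hyperplane that does not contain [e_d (dom i)],
    where [d] bounds the degree of [r] ([closed_avoided_by_subspace]).  The span
    of the chosen points lying on the hyperplane never contains [e_d (dom i)],
    hence from index [d] on every new such point raises its dimension by one,
    which can happen at most [N d] times ([general_position_sequence]).

    Thus only finitely many indices give a point of [Z].  For [Z] a single
    point, which is closed and proper in positive dimension, this also shows
    that the sequence takes infinitely many values. *)

(** * Irreducible spaces *)

Lemma irreducible_open_dense {T : topologicalType} (A : set T) :
  irreducible_set [set: T] -> open A -> A !=set0 -> dense A.
Proof.
move=> [_ irrT] oA [a Aa] O [o Oo] oO; apply: contrapT => /nonemptyPn OA0.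
have cover : [set: T] `<=` ~` O `|` ~` A.
  move=> x _; case: (pselect (O x)) => [Ox|]; last by left.
  by right=> Ax; suff : set0 x by []; rewrite -OA0.
have := irrT _ _ (open_closedC oO) (open_closedC oA) cover.
by case=> sub; [apply: (sub o)|apply: (sub a)].
Qed.

(** A dense set meets the intersection of finitely many nonempty open sets.
    Nonemptiness is a premise for each [i] separately, so that a condition that
    no point satisfies can stay in the list. *)
Lemma irreducible_dense_meets_opens {T : topologicalType} {I : eqType}
    (D : set T) (W : I -> set T) (s : seq I) :
  irreducible_set [set: T] -> dense D -> (forall i, open (W i)) ->
  exists2 x, D x & forall i, i \in s -> W i !=set0 -> W i x.
Proof.
move=> irrT denseD oW.
(* Density, not mere nonemptiness, is what passes through the induction. *)
suff : dense [set x | D x /\ forall i, i \in s -> W i !=set0 -> W i x].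
  case: irrT => [neT _] /(_ setT neT openT) [x [_ [Dx Wx]]].
  by exists x.
elim: s => [|i s IHs].
  by congr dense: denseD; apply/seteqP; split=> x //= [].
case: (pselect (W i !=set0)) => [neW|W0].
  have := denseI (oW i) (irreducible_open_dense _ irrT (oW i) neW) IHs.
  congr dense; apply/seteqP; split=> x /=.
    move=> [Wx [Dx sx]]; split=> // j; rewrite inE => /predU1P[-> //|].
    exact: sx.
  move=> [Dx sx]; split; first by apply: sx; rewrite ?mem_head.
  by split=> // j js; apply: sx; rewrite inE js orbT.
congr dense: IHs; apply/seteqP; split=> x /= [Dx sx]; split=> // j.
  by rewrite inE => /predU1P[-> //|]; apply: sx.
by move=> js; apply: sx; rewrite inE js orbT.
Qed.

(** * Sequences in general position *)

(** A bounded nondecreasing sequence is constant from the index on at which it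
    attains its maximum. *)
Lemma finite_jumps (f : nat -> nat) (B : nat) :
  (forall n, (f n <= B)%N) -> (forall n, (f n <= f n.+1)%N) ->
  finite_set [set n | (f n < f n.+1)%N].
Proof.
move=> fB fS.
have ex : exists v, `[< exists n, f n = v >].
  by exists (f 0%N); apply/asboolP; exists 0%N.
have ub v : `[< exists n, f n = v >] -> (v <= B)%N by move=> /asboolP[n <-].
case: (ex_maxnP ex ub) => v /asboolP[m fm] vmax.
apply: (sub_finite_set _ (finite_II m)) => n /= jump.
rewrite ltnNge; apply/negP => mn.
have mono : {homo f : i j / (i <= j)%N}.
  by apply: homo_leq => [//|j i l|//]; exact: leq_trans.
have : (v < f n.+1)%N by rewrite -fm; apply: leq_ltn_trans jump; apply: mono.
by rewrite ltnNge vmax //; apply/asboolP; exists n.+1.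
Qed.

Definition span_of {T : Type} {K : fieldType} {N : nat} (e : T -> 'rV[K]_N)
    (s : seq T) : 'M[K]_N :=
  foldr (fun x U => (e x + U)%MS) 0 s.

Lemma span_of_sub {T : Type} {K : fieldType} {N : nat} (e : T -> 'rV[K]_N)
    (s : seq T) (U : 'M[K]_N) :
  all (fun x => (e x <= U)%MS) s -> (span_of e s <= U)%MS.
Proof.
elim: s => [|x s IHs] /=; first by rewrite sub0mx.
by move=> /andP[xU sU]; rewrite addsmx_sub xU IHs.
Qed.

Definition subsequences {T : Type} (s : seq T) : seq (seq T) :=
  [seq mask (tval m) s | m <- enum {: (size s).-tuple bool}].

Lemma mem_subsequences {T : eqType} (s t : seq T) :
  subseq t s -> t \in subsequences s.
Proof.
case/subseqP => m /eqP sz ->; apply/mapP; exists (Tuple sz) => //.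
by rewrite mem_enum.
Qed.

Definition off_subspace {T : Type} {K : fieldType} {N : nat} (O : set T)
    (e : T -> 'rV[K]_N) (U : 'M[K]_N) : set T :=
  [set x | O x /\ ~~ (e x <= U)%MS].

(** The counting argument, for arbitrary vector-valued functions [e d].  The set
    [O] is the domain on which they make sense; the conclusion for any one pair
    [(d, U)] says in particular that almost all the points are in [O].

    Requiring independence from every subsequence of the earlier points, and
    not only from all of them, is what makes the bound work: the earlier points
    outside [U] may well span everything, and only those in [U] are
    relevant. *)
Lemma general_position_sequence {T : topologicalType} {K : fieldType}
    (D O : set T) (N : nat -> nat) (e : forall d, T -> 'rV[K]_(N d)) :
  irreducible_set [set: T] -> dense D ->
  (forall d U, open (off_subspace O (e d) U)) ->
  exists2 x : nat -> T, (forall n, D (x n)) &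
    forall d U, off_subspace O (e d) U !=set0 ->
      finite_set [set n | ~ off_subspace O (e d) U (x n)].
Proof.
move=> irrT denseD oW.
pose W (q : nat * seq T) := off_subspace O (e q.1) (span_of (e q.1) q.2).
pose Q (s : seq T) := [seq (d, t) | d <- iota 0 (size s).+1, t <- subsequences s].
have /choice[next nextP] (s : seq T) :
    exists x, D x /\ forall q, q \in Q s -> W q !=set0 -> W q x.
  have oWq q : open (W q) by apply: oW.
  by have [x] := irreducible_dense_meets_opens D W (Q s) irrT denseD oWq; exists x.
(* [L n] lists the first [n] points, the most recent first. *)
pose L := fix L n := if n is m.+1 then next (L m) :: L m else [::].
have sizeL n : size (L n) = n by elim: n => //= n ->.
exists (fun n => next (L n)) => [n|d U [y [Oy yU]]]; first by have [] := nextP (L n).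
(* [S n] collects the first [n] points that lie in [U]; its span stays inside
   [U], so the genericity condition for [S n] is never vacuous. *)
pose S n := [seq z <- L n | (e d z <= U)%MS].
pose f n := \rank (span_of (e d) (S n)).
have Ssub n : (span_of (e d) (S n) <= U)%MS by apply/span_of_sub/filter_all.
have Wnext n : (d <= n)%N -> W (d, S n) (next (L n)).
  move=> dn; have [_ /(_ (d, S n))] := nextP (L n); apply.
    apply/allpairsP; exists (d, S n); split=> //.
      by rewrite mem_iota add0n sizeL ltnS.
    exact/mem_subsequences/filter_subseq.
  exists y; split=> //=; apply: contra yU => yS; exact: submx_trans yS (Ssub n).
have fS n : (f n <= f n.+1)%N.
  by rewrite /f /S /=; case: ifP => //= _; apply/mxrankS/addsmxSr.
have jump n : (d <= n)%N -> ~ off_subspace O (e d) U (next (L n)) -> (f n < f n.+1)%N.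
  move=> dn notW; have [/= Ox xS] := Wnext n dn.
  have xU : (e d (next (L n)) <= U)%MS.
    by apply: contrapT => /negP xU; apply: notW.
  rewrite /f /S /= xU /= -/(S n); apply: rank_ltmx.
  by rewrite ltmxE addsmxSr addsmx_sub (negPf xS).
have finJ := finite_jumps f (N d) (fun n => rank_leq_col _) fS.
apply: sub_finite_set (_ : finite_set (`I_d `|` [set n | (f n < f n.+1)%N])).
  move=> n /= bad; case: (ltnP n d) => dn; [by left|right; exact: jump].
by rewrite finite_setU; split=> //; exact: finite_II.
Qed.

(** * Locally rational functions *)

(** Regularity of [g] at [x] in the coordinates [c], on the domain [A]: this is
    the shape in which the coordinates of transition maps are given. *)
Definition fraction_near {T : Type} {K : fieldType} {n : nat} (A : set T)
    (c : T -> 'rV[K]_n) (x : T) (g : T -> K) : Prop :=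
  exists P Q : {mpoly K[n]}, poly_eval Q (c x) != 0 /\
    forall y, A y -> poly_eval Q (c y) != 0 ->
      g y = poly_eval P (c y) / poly_eval Q (c y).

Section FractionNear.
Context {T : Type} {K : fieldType} {n : nat} (A : set T) (c : T -> 'rV[K]_n) (x : T).
Local Notation frac := (fraction_near A c x).

Lemma fraction_near_const (a : K) : frac (fun=> a).
Proof.
exists a%:MP, 1; rewrite /poly_eval meval1 oner_neq0; split=> // y _ _.
by rewrite meval1 mevalC divr1.
Qed.

Lemma fraction_nearD (g h : T -> K) : frac g -> frac h -> frac (fun y => g y + h y).
Proof.
move=> [P [Q [Qx gE]]] [P' [Q' [Q'x hE]]].
exists (P * Q' + P' * Q), (Q * Q'); rewrite /poly_eval in Qx gE Q'x hE *.
rewrite !mevalM mulf_neq0 //; split=> // y Ay.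
rewrite mevalM mulf_eq0 negb_or => /andP[Qy Q'y].
by rewrite gE // hE // mevalD !mevalM addf_div.
Qed.

Lemma fraction_nearM (g h : T -> K) : frac g -> frac h -> frac (fun y => g y * h y).
Proof.
move=> [P [Q [Qx gE]]] [P' [Q' [Q'x hE]]].
exists (P * P'), (Q * Q'); rewrite /poly_eval in Qx gE Q'x hE *.
rewrite !mevalM mulf_neq0 //; split=> // y Ay.
rewrite mevalM mulf_eq0 negb_or => /andP[Qy Q'y].
by rewrite gE // hE // mevalM mulf_div.
Qed.

Lemma fraction_near_sum {I : Type} (r : seq I) (F : I -> T -> K) :
  (forall i, frac (F i)) -> frac (fun y => \sum_(i <- r) F i y).
Proof.
move=> fracF; elim: r => [|i r IHr].
  under eq_fun do rewrite big_nil.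
  exact: fraction_near_const.
under eq_fun do rewrite big_cons.
exact: fraction_nearD.
Qed.

Lemma fraction_near_prod {I : Type} (r : seq I) (F : I -> T -> K) :
  (forall i, frac (F i)) -> frac (fun y => \prod_(i <- r) F i y).
Proof.
move=> fracF; elim: r => [|i r IHr].
  under eq_fun do rewrite big_nil.
  exact: fraction_near_const.
under eq_fun do rewrite big_cons.
exact: fraction_nearM.
Qed.

Lemma fraction_near_poly {m : nat} (p : {mpoly K[m]}) (v : T -> 'rV[K]_m) :
  (forall l, frac (fun y => v y 0 l)) -> frac (fun y => poly_eval p (v y)).
Proof.
move=> fracv; rewrite /poly_eval; under eq_fun do rewrite mevalE.
apply: fraction_near_sum => mon.
apply: fraction_nearM; first exact: fraction_near_const.
apply: fraction_near_prod => l; elim: (mon l) => [|k IHk].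
  under eq_fun do rewrite expr0.
  exact: fraction_near_const.
under eq_fun do rewrite exprS.
exact: fraction_nearM.
Qed.

End FractionNear.

(** * The topology of a variety *)

(** Zariski closed sets are the zero loci of their own vanishing ideals; this
    and [zariski_closed_sepP] give the pointwise form of that fact. *)
Lemma zariski_closed_sep {K : fieldType} {n : nat} (X : set 'rV[K]_n) :
  (forall a, ~ X a -> exists2 r, vanishing_ideal X r & poly_eval r a != 0) ->
  zariski_closed X.
Proof.
move=> sep; exists (vanishing_ideal X); apply/seteqP; split=> a.
  by move=> Xa p; apply.
move=> aZ; apply: contrapT => /sep[r rX].
by rewrite aZ ?eqxx.
Qed.

Lemma zariski_closed_sepP {K : fieldType} {n : nat} {X : set 'rV[K]_n} {a : 'rV[K]_n} :
  zariski_closed X -> ~ X a -> exists2 r, vanishing_ideal X r & poly_eval r a != 0.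
Proof.
move=> [S ->] /existsNP[p /not_implyP[Sp /eqP pa]].
by exists p => // b; apply.
Qed.

Section VarietyTopology.
Context {k : fieldType} {K : closedFieldType} {iota : {rmorphism k -> K}}.
Variable V : variety iota.

Definition chart_nonzero (i : chart_index V) (p : {mpoly K[emb_dim i]}) : set V :=
  [set x | dom i x /\ poly_eval p (chart i x) != 0].

(** A principal open set of one chart is open in the whole space.  The topology
    is described chart by chart, so the complement has to be shown closed in
    each chart [j].  Around a point [y] of the overlap, the function [p] read
    in chart [j] is a fraction [P / Q].  With [s] an equation that vanishes on
    the part of chart [j] outside [dom i] but not at [y], the polynomial
    [s * P * Q] vanishes on the complement of the principal open set and not
    at [y]. *)
Lemma chart_nonzero_open (i : chart_index V) (p : {mpoly K[emb_dim i]}) :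
  open (chart_nonzero i p).
Proof.
rewrite -closedC; apply/Defs.closedE => j; apply: zariski_closed_sep => a aX.
case: (pselect ((chart j @` dom j) a)) => [[y yj ya]|aD]; last first.
  have [r rX ra] := zariski_closed_sepP (proj1 (chart_image j)) aD.
  by exists r => // b [z [zj _] zb]; apply: rX; exists z.
have [yi py] : chart_nonzero i p y.
  by apply: contrapT => py; apply: aX; exists y.
have yov : ~ (chart j @` (dom j `\` dom i)) (chart j y).
  by move=> [z [zj zi] /(chart_inj zj yj) zy]; apply: zi; rewrite zy.
have [s sX sy] : exists2 s, vanishing_ideal (chart j @` (dom j `\` dom i)) s
    & poly_eval s (chart j y) != 0.
  apply: zariski_closed_sepP yov.
  by have [S ->] := overlap j i; eexists.
have [P [Q [Qy PQ]]] : fraction_near (dom j `&` dom i) (chart j) y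
    (fun z => poly_eval p (chart i z)).
  apply: fraction_near_poly => l.
  have [P [Q [Qy PQ]]] := transition l yj yi.
  exists (extend_poly iota P), (extend_poly iota Q); split=> // z [zj zi].
  exact: PQ.
exists (s * P * Q); last first.
  rewrite -ya /poly_eval !mevalM !mulf_neq0 //.
  apply: contraNneq py => P0; rewrite (PQ y) //.
  by rewrite /poly_eval P0 mul0r.
move=> b [z [zj zp] <-]; apply/eqP; apply/negPn; apply/negP.
rewrite /poly_eval !mevalM !mulf_eq0 !negb_or => /andP[/andP[sz Pz] Qz].
have zi : dom i z.
  apply: contrapT => zi; move/eqP: sz; apply.
  by apply: sX; exists z.
by apply: zp; split=> //; rewrite (PQ z) // mulf_neq0 ?invr_eq0.
Qed.

Lemma point_closed (x : V) : closed [set x].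
Proof.
apply/Defs.closedE => j; apply: zariski_closed_sep => a aX.
case: (pselect (dom j x)) => [xj|xj]; last first.
  exists 1; last by rewrite /poly_eval meval1 oner_neq0.
  by move=> b [z [zj zx] _]; case: xj; rewrite -zx.
have [l al] : exists l, a 0 l != chart j x 0 l.
  apply: contrapT => /forallNP eqa; apply: aX; exists x => //.
  by apply/rowP => l; apply/esym/eqP/negPn/negP/eqa.
exists ('X_l - (chart j x 0 l)%:MP).
  move=> b [z [_ ->] <-].
  by rewrite /poly_eval mevalB mevalXU mevalC subrr.
by rewrite /poly_eval mevalB mevalXU mevalC subr_eq0.
Qed.

(** In a one-point space every chain of irreducible closed sets has length
    zero. *)
Lemma krull_dim_gt0_nontrivial (x : V) : (0 < krull_dim V)%N -> [set x] <> [set: V].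
Proof.
rewrite /krull_dim; case: xgetP => [d _ [[Z [irrZ ltZ]] _] d_gt0 xV|//].
have [_ [[y Z0y] _]] := irrZ 0%N (leq0n d).
have [sub01 neq01] := ltZ 0%N d_gt0.
apply: neq01 => z _; suff -> : z = y by [].
have allx w : w = x by have : [set: V] w by []; rewrite -xV.
by rewrite (allx z) (allx y).
Qed.

(** * Closed sets and spaces of monomials *)

Definition monomial_row {n : nat} (d : nat) (a : 'rV[K]_n) :
    'rV[K]_#|{: 'X_{1..n < d}}| :=
  \row_m poly_eval 'X_[bmnm (enum_val m)] a.

Lemma monomial_row_mul {n d : nat} (a : 'rV[K]_n) (c : 'cV[K]_#|{: 'X_{1..n < d}}|) :
  (monomial_row d a *m c) 0 0 =
  poly_eval (\sum_m c m 0 *: 'X_[bmnm (enum_val m)]) a.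
Proof.
rewrite mxE /poly_eval raddf_sum /=.
by apply: eq_bigr => m _; rewrite mevalZ mxE mulrC.
Qed.

Lemma poly_eval_monomial_row {n : nat} (p : {mpoly K[n]}) :
  exists c : 'cV[K]_#|{: 'X_{1..n < msize p}}|, forall a,
    poly_eval p a = (monomial_row (msize p) a *m c) 0 0.
Proof.
exists (\col_m p@_(bmnm (enum_val m))) => a; rewrite monomial_row_mul.
rewrite {1}(mpolywE (leqnn (msize p))) (reindex _ (onW_bij _ (enum_val_bij _))) /=.
by congr poly_eval; apply: eq_bigr => m _; rewrite mxE.
Qed.

(** Membership in the row space of [U] is the vanishing of the coordinates
    given by [cokermx U], and each of these is a polynomial in the chart. *)
Lemma off_subspace_open (i : chart_index V) (d : nat)
    (U : 'M[K]_#|{: 'X_{1..(emb_dim i) < d}}|) :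
  open (off_subspace (dom i) (fun x => monomial_row d (chart i x)) U).
Proof.
pose r j := \sum_m cokermx U m j *: 'X_[bmnm (enum_val m)] : {mpoly K[emb_dim i]}.
suff -> : off_subspace (dom i) (fun x => monomial_row d (chart i x)) U =
    \bigcup_(j in setT) chart_nonzero i (r j).
  by apply: bigcup_open => j _; exact: chart_nonzero_open.
have coordE x j : (monomial_row d (chart i x) *m cokermx U) 0 j =
    poly_eval (r j) (chart i x).
  transitivity ((monomial_row d (chart i x) *m col j (cokermx U)) 0 0).
    by rewrite !mxE; apply: eq_bigr => m _; rewrite !mxE.
  by rewrite monomial_row_mul; congr poly_eval; apply: eq_bigr => m _; rewrite mxE.
apply/seteqP; split=> x /=.
  move=> [xi xU]; apply: contrapT => none; move/negP: xU; apply.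
  rewrite submxE; apply/eqP/rowP => j; rewrite coordE mxE.
  by apply/eqP/negPn/negP => rx; apply: none; exists j.
move=> [j _ [xi rx]]; split=> //; apply: contra rx.
by rewrite submxE -coordE => /eqP ->; rewrite mxE.
Qed.

(** A polynomial that vanishes on [Z] in the chart, but not on the whole chart,
    is a linear form in the monomials, and [U] is the kernel of that form.  Such
    a polynomial exists because [dom i] is dense, hence not contained in
    [Z]. *)
Lemma closed_avoided_by_subspace (i : chart_index V) (x : V) (Z : set V) :
  dom i x -> closed Z -> Z <> [set: V] ->
  exists (d : nat) (U : 'M[K]_#|{: 'X_{1..(emb_dim i) < d}}|),
    let W := off_subspace (dom i) (fun y => monomial_row d (chart i y)) U in
    W !=set0 /\ W `<=` ~` Z.
Proof.
move=> xi cZ ZV.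
(* [dom i] is the principal open set of the constant polynomial 1. *)
have domO : open (dom i).
  have := chart_nonzero_open i 1; congr open; apply/seteqP; split=> y.
    by case.
  by move=> yi; split=> //; rewrite /poly_eval meval1 oner_neq0.
have neZ : ~` Z !=set0.
  apply: contrapT => /nonemptyPn Z0; apply: ZV.
  by rewrite -(setCK Z) Z0 setC0.
have oZ : open (~` Z) by rewrite openC.
have [y [yi yZ]] : (dom i `&` ~` Z) !=set0.
  by apply: (irreducible_open_dense _ (variety_irreducible V) oZ neZ) => //; exists x.
have yX : ~ (chart i @` (dom i `&` Z)) (chart i y).
  by move=> [z [zi zZ] /(chart_inj zi yi) zy]; apply: yZ; rewrite -zy.
have [r rX ry] := zariski_closed_sepP (proj1 (Defs.closedE Z) cZ i) yX.
have [c rE] := poly_eval_monomial_row r.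
have kerE z : (monomial_row (msize r) (chart i z) <= kermx c)%MS =
    (poly_eval r (chart i z) == 0).
  rewrite sub_kermx rE; apply/eqP/eqP => [->|rz]; first by rewrite mxE.
  by apply/matrixP => a b; rewrite !ord1 rz mxE.
exists (msize r), (kermx c); split; first by exists y; split=> //; rewrite kerE.
move=> z [zi]; rewrite kerE => /eqP rz zZ; apply: rz.
by apply: rX; exists z.
Qed.

End VarietyTopology.

Theorem proposition4 (k : fieldType) (K : closedFieldType)
    (iota : {rmorphism k -> K}) (V : variety iota)
    (dimV : (0 < krull_dim V)%N) (densV : dense (rational_points V)) :
  exists Gamma : set V,
    [/\ infinite_set Gamma,
        Gamma `<=` rational_points V &
        forall Z : set V, proper_subvariety Z -> finite_set (Gamma `&` Z)].
Proof.
have [[x0 _] _] := variety_irreducible V; have [i x0i] := dom_cover x0.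
have [x xk xgen] := general_position_sequence (rational_points V) (dom i) _
  (fun d y => monomial_row d (chart i y)) (variety_irreducible V) densV
  (off_subspace_open V i).
have finZ Z : closed Z -> Z <> [set: V] -> finite_set (x @^-1` Z).
  move=> cZ ZV; have [d [U [neW WZ]]] := closed_avoided_by_subspace V i x0 Z x0i cZ ZV.
  by apply: sub_finite_set (xgen d U neW) => n /= Zx Wx; exact: WZ Wx Zx.
exists (range x); split.
- move=> finG; apply: infinite_nat.
  apply: sub_finite_set (bigcup_finite finG (fun y _ =>
    finZ [set y] (point_closed V y) (krull_dim_gt0_nontrivial V y dimV))).
  by move=> n _; exists (x n) => //; exists n.
- by move=> _ [n _ <-].
move=> Z [[cZ _] ZV]; apply: sub_finite_set (finite_image x (finZ Z cZ ZV)).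
by move=> _ [[n _ <-] Zx]; exists n.
Qed.
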